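(* For every integer $n\ge1$, the optimal winning probability of the $n$-fold parallel repetition of the two-party quantum cloning game satisfies $$\left(\frac34\right)^n\le\omega^*(\mathrm{QCG}_2^{\times n})\le\left(\frac12+\frac1{2\sqrt2}\right)^n.$$
   Context: Notation: $[n]=\{0,\dots,n-1\}$; $|\Phi^+\rangle=\frac1{\sqrt2}(|00\rangle+|11\rangle)$. The game $\mathrm{QCG}_2^{\times n}$: a referee holds $n$ qubit registers $R=R_0\ldots R_{n-1}$; two collaborating, non-communicating players, Alice and Bob, have $n$ qubit registers $A=A_0\ldots A_{n-1}$ and $B=B_0\ldots B_{n-1}$, respectively, together with auxiliary systems $E_A$ and $E_B$ of arbitrary finite dimension. Before the game they prepare an arbitrary joint quantum state $\rho$ on $R\,AE_A\,BE_B$. The referee draws $x=x_0\ldots x_{n-1}\in\{0,1\}^n$ uniformly at random and sends $x$ to both players. They then apply local completely positive trace-preserving maps depending on $x$, $\mathcal E^x_{AE_A\to A}$ (Alice) and $\mathcal F^x_{BE_B\to B}$ (Bob). The players win iff, for every $i\in[n]$, the projection onto $|\Phi^+\rangle_{R_iQ_{x_i}}$ succeeds, where $Q_{x_i}=A_i$ if $x_i=0$ and $Q_{x_i}=B_i$ if $x_i=1$. Thus a strategy $S=(\rho,\{\mathcal E^x\},\{\mathcal F^x\})$ has winning probability $$\omega(\mathrm{QCG}_2^{\times n},S)=\frac1{2^n}\sum_{x\in\{0,1\}^n}\mathrm{Tr}\Big[\Big(\bigotimes_{i\in[n]}|\Phi^+\rangle\langle\Phi^+|_{R_iQ_{x_i}}\otimes\mathbb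 I_{Q_{1-x_i}}\Big)\,(\mathrm{id}_R\otimes\mathcal E^x\otimes\mathcal F^x)(\rho)\Big],$$ where $Q_{1-x_i}$ denotes the other one of the two registers $A_i,B_i$, and $\omega^*(\mathrm{QCG}_2^{\times n})=\sup_S\omega(\mathrm{QCG}_2^{\times n},S)$ over all strategies (over all auxiliary systems). *)

(* Defs.v *)
From mathcomp Require Import all_boot all_order all_algebra.
From mathcomp Require Import complex mxtens.
From mathcomp Require Import classical_sets reals.

Set Implicit Arguments.
Unset Strict Implicit.
Unset Printing Implicit Defensive.

Import Order.TTheory GRing.Theory Num.Theory.

Local Open Scope ring_scope.
Local Open Scope complex_scope.
Local Open Scope classical_set_scope.

Section QuantumInformation.
Variable C : numClosedFieldType.

Definition adjoint (m n : nat) (A : 'M[C]_(m, n)) : 'M[C]_(n, m) :=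
  map_mx Num.conj A^T.

(* In a numClosedFieldType [0 <= z] entails that z is real, so that a
   positive semidefinite matrix is automatically Hermitian. *)
Definition psdmx (n : nat) (A : 'M[C]_n) : Prop :=
  forall v : 'cV[C]_n, 0 <= (adjoint v *m A *m v) 0 0.

Definition quantum_state (n : nat) (rho : 'M[C]_n) : Prop :=
  psdmx rho /\ \tr rho = 1.

(* The tensor product of two linear maps, i.e. the linear map determined by
   (L (x) M) (A *t B) = L A *t M B, computed on the basis of matrix units. *)
Definition tensmap (m m' n n' : nat)
    (L : 'M[C]_m -> 'M[C]_m') (M : 'M[C]_n -> 'M[C]_n')
    (X : 'M[C]_(m * n)) : 'M[C]_(m' * n') :=
  \sum_(i < m) \sum_(i' < m) \sum_(j < n) \sum_(j' < n)
    X (mxtens_index (i, j)) (mxtens_index (i', j')) *: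
      (L (delta_mx i i') *t M (delta_mx j j')).

Lemma tensmap_tens (m m' n n' : nat)
    (L : {linear 'M[C]_m -> 'M[C]_m'}) (M : {linear 'M[C]_n -> 'M[C]_n'})
    (A : 'M[C]_m) (B : 'M[C]_n) :
  tensmap L M (A *t B) = L A *t M B.
Proof.
rewrite {2}(matrix_sum_delta A) {2}(matrix_sum_delta B).
apply/matrixP => p q; rewrite !mxE /tensmap !summxE linear_sum.
rewrite summxE mulr_suml; apply: eq_bigr => i _.
rewrite linear_sum !summxE mulr_suml; apply: eq_bigr => i' _.
rewrite linear_sum !summxE mulr_sumr; apply: eq_bigr => j _.
rewrite linear_sum !summxE mulr_sumr; apply: eq_bigr => j' _.
by rewrite tensmxE !linearZ !mxE /= mulrACA.
Qed.

Definition completely_positive (m n : nat) (L : 'M[C]_m -> 'M[C]_n) : Prop :=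
  forall (k : nat) (X : 'M[C]_(k * m)),
    psdmx X -> psdmx (tensmap (@idfun 'M[C]_k) L X).

Definition trace_preserving (m n : nat) (L : 'M[C]_m -> 'M[C]_n) : Prop :=
  forall X : 'M[C]_m, \tr (L X) = \tr X.

Record channel (m n : nat) : Type := Channel {
  channel_map :> {linear 'M[C]_m -> 'M[C]_n};
  channel_cp : completely_positive channel_map;
  channel_tp : trace_preserving channel_map }.

Definition ket (b : 'I_2) : 'cV[C]_2 := delta_mx b 0.

Definition phi_plus : 'cV[C]_(2 * 2) :=
  (sqrtC 2)^-1 *: (ket 0 *t ket 0 + ket 1 *t ket 1).

Definition phi_plus_proj : 'M[C]_(2 * 2) := phi_plus *m adjoint phi_plus.

End QuantumInformation.

Definition bits (n : nat) : finType := {ffun 'I_n -> 'I_2}.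

(* The dimension 2 ^ n of an n-qubit register; the computational basis vector
   |b> with b : bits n is the one of index enum_rank b. *)
Definition qdim (n : nat) : nat := #|bits n|.

Section CloningGame.
Variables (R : realType) (n : nat).

(* Registers are ordered R (x) ((A (x) E_A) (x) (B (x) E_B)) before, and
   R (x) (A (x) B) after, the application of the players' channels. *)
Record strategy : Type := Strategy {
  dimEA : nat;
  dimEB : nat;
  shared_state : 'M[R[i]]_(qdim n * ((qdim n * dimEA) * (qdim n * dimEB)));
  shared_stateP : quantum_state shared_state;
  alice : bits n -> channel R[i] (qdim n * dimEA) (qdim n);
  bob : bits n -> channel R[i] (qdim n * dimEB) (qdim n) }.

Definition final_state (S : strategy) (x : bits n) :
    'M[R[i]]_(qdim n * (qdim n * qdim n)) :=
  tensmap (@idfun 'M[R[i]]_(qdim n)) (tensmap (alice S x) (bob S x))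
    (shared_state S).

Definition reg_R (p : 'I_(qdim n * (qdim n * qdim n))) : bits n :=
  enum_val (mxtens_unindex p).1.
Definition reg_A (p : 'I_(qdim n * (qdim n * qdim n))) : bits n :=
  enum_val (mxtens_unindex (mxtens_unindex p).2).1.
Definition reg_B (p : 'I_(qdim n * (qdim n * qdim n))) : bits n :=
  enum_val (mxtens_unindex (mxtens_unindex p).2).2.

(* The bit of the basis vector p in the register Q_c of index i, where
   Q_0 = A and Q_1 = B. *)
Definition reg_Q (c : 'I_2) (p : 'I_(qdim n * (qdim n * qdim n))) (i : 'I_n) :
    'I_2 :=
  if c == 0 then reg_A p i else reg_B p i.

(* Entrywise form of the tensor product over i of
   |Phi+><Phi+| on R_i Q_(x_i) and of the identity on Q_(1 - x_i). *)
Definition winning_proj (x : bits n) : 'M[R[i]]_(qdim n * (qdim n * qdim n)) :=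
  \matrix_(p, q) \prod_(i < n)
    (phi_plus_proj R[i] (mxtens_index (reg_R p i, reg_Q (x i) p i))
                        (mxtens_index (reg_R q i, reg_Q (x i) q i))
     * (1%:M : 'M[R[i]]_2) (reg_Q (1 - x i) p i) (reg_Q (1 - x i) q i)).

(* The trace is a nonnegative real number; Re only changes its type. *)
Definition winning_probability (S : strategy) : R :=
  (2 ^+ n)^-1 *
  \sum_(x : bits n) complex.Re (\tr (winning_proj x *m final_state S x)).

Definition optimal_winning_probability : R := sup (range winning_probability).

End CloningGame.

(* Main.v *)
Require Import Defs.
From mathcomp Require Import all_boot all_order all_algebra reals.
From mathcomp Require Import complex mxtens spectral sesquilinear.
From mathcomp Require Import boolp classical_sets.
From mathcomp Require Import ring lra.

(** Upper bound.  Let [T_x] be the isometry built from Kraus operators of the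
   two players on input [x], [W_x] the winning projection, and
   [u_x = W_x T_x psi].  Then [sum_x |u_x|^2 = <psi, sum_x T_x^* u_x>], so a
   Schur test reduces the bound to
     [2 Re <T_x^* u_x, T_y^* u_y> <= c_xy (|u_x|^2 + |u_y|^2)]
   with [c_xy = 2^(-d(x,y)/2)], since [sum_y c_xy = (1 + 1/sqrt 2)^n].
   For [S = {i | x_i = 0, y_i = 1}], [u_x] is fixed by the projection onto
   [Phi+] on [R_S A_S], which commutes with Bob's operators, and [u_y] by the
   one on [R_S B_S], which commutes with Alice's.  The product of these two
   projections has norm [2^(-|S|)]; exchanging [x] and [y] if necessary makes
   this at most [c_xy].

   Lower bound.  The players share [n] copies of the state proportional to
   [|Phi+>_RA |0>_B + |Phi+>_RB |0>_A] and apply no operation. *)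

Set Implicit Arguments.
Unset Strict Implicit.
Unset Printing Implicit Defensive.

Import Order.TTheory GRing.Theory Num.Theory.

Local Open Scope ring_scope.
Local Open Scope complex_scope.
Local Arguments mxtens_unindex : simpl never.
Local Arguments mxtens_index : simpl never.

Local Notation qubits3 := ('I_2 * 'I_2 * 'I_2)%type.
Local Notation bits3 n := (bits n * bits n * bits n)%type.

(** * Real inner products of complex vectors *)

Section InnerProduct.
Variable R : realType.
Local Notation C := R[i].

Lemma Re_add (a b : C) : complex.Re (a + b) = complex.Re a + complex.Re b.
Proof. by case: a b => [a1 a2] [b1 b2]. Qed.

Lemma Re_sum (I : finType) (F : I -> C) :
  complex.Re (\sum_i F i) = \sum_i complex.Re (F i).
Proof. exact: (big_morph _ Re_add (erefl _)). Qed.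

Lemma Re_conj (a : C) : complex.Re (Num.conj a) = complex.Re a.
Proof. by case: a. Qed.

Definition dot (T : finType) (u v : T -> C) : C := \sum_t Num.conj (u t) * v t.
Definition rdot (T : finType) (u v : T -> C) : R := complex.Re (dot u v).

Lemma rdotC (T : finType) (u v : T -> C) : rdot u v = rdot v u.
Proof.
rewrite /rdot -[RHS]Re_conj /dot rmorph_sum; congr complex.Re.
by apply: eq_bigr => t _; rewrite rmorphM /= conjCK mulrC.
Qed.

(** The expression is the squared norm of [c u - v]. The Cauchy-Schwarz type estimates below come
    from it by a choice of [c]. *)
Lemma rdot_quad (T : finType) (c : R) (u v : T -> C) :
  0 <= c ^+ 2 * rdot u u - 2 * c * rdot u v + rdot v v.
Proof.
rewrite /rdot /dot !Re_sum !mulr_sumr -sumrB -big_split /=.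
apply: sumr_ge0 => t _; case: (u t) (v t) => [a1 a2] [b1 b2].
have := addr_ge0 (sqr_ge0 (c * a1 - b1)) (sqr_ge0 (c * a2 - b2)).
rewrite /=; congr (_ <= _).
ring.
Qed.

Lemma rdot_ge0 (T : finType) (u : T -> C) : 0 <= rdot u u.
Proof. by have := rdot_quad 0 u u; lra. Qed.

Lemma rdot_suml (T I : finType) (w : I -> T -> C) (v : T -> C) :
  rdot (fun t => \sum_i w i t) v = \sum_i rdot (w i) v.
Proof.
rewrite /rdot /dot -Re_sum; congr complex.Re.
rewrite exchange_big; apply: eq_bigr => t _.
by rewrite rmorph_sum mulr_suml.
Qed.

Lemma rdot_sumr (T I : finType) (w : I -> T -> C) (v : T -> C) :
  rdot v (fun t => \sum_i w i t) = \sum_i rdot v (w i).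
Proof. by rewrite rdotC rdot_suml; apply: eq_bigr => i _; rewrite rdotC. Qed.

(** Schur test. For the sum [S] of the [w x], the symmetry and the row sums of [c] give
    [|S|^2 <= l * sum N], while [<psi, S> = sum N]. Expanding [|l psi - S|^2 >= 0] and dividing by
    [l] then yields the bound. *)
Lemma gram_bound (T I : finType) (psi : T -> C) (w : I -> T -> C) (N : I -> R)
    (c : I -> I -> R) (l : R) :
  0 < l -> (forall x y, c x y = c y x) -> (forall x, \sum_y c x y = l) ->
  (forall x, rdot psi (w x) = N x) ->
  (forall x y, 2 * rdot (w x) (w y) <= c x y * (N x + N y)) ->
  \sum_x N x <= l * rdot psi psi.
Proof.
move=> l0 cC cl psiw ww.
pose S t := \sum_x w x t.
have HS : rdot S S <= l * \sum_x N x.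
  rewrite /S rdot_suml.
  under eq_bigr do rewrite rdot_sumr.
  have -> : l * \sum_x N x = \sum_x \sum_y c x y * (N x + N y) / 2.
    transitivity (\sum_x \sum_y (c x y * N x / 2) + \sum_x \sum_y (c x y * N y / 2)).
      have E1 : \sum_x \sum_y (c x y * N x / 2) = l * (\sum_x N x) / 2.
        rewrite mulr_sumr mulr_suml; apply: eq_bigr => x _.
        by rewrite -(cl x) !mulr_suml.
      have -> : \sum_x \sum_y (c x y * N y / 2) = \sum_x \sum_y (c x y * N x / 2).
        rewrite exchange_big; apply: eq_bigr => x _; apply: eq_bigr => y _.
        by rewrite cC.
      by rewrite E1; field.
    rewrite -big_split; apply: eq_bigr => x _ /=; rewrite -big_split.
    by apply: eq_bigr => y _ /=; rewrite mulrDr mulrDl.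
  apply: ler_sum => x _; apply: ler_sum => y _.
  by rewrite ler_pdivlMr // mulrC ww.
have := rdot_quad l psi S.
rewrite {1}/S rdot_sumr (eq_bigr _ (fun x _ => psiw x)) => HQ.
have : 0 <= l * (l * rdot psi psi - \sum_x N x) by lra.
by rewrite pmulr_rge0 // subr_ge0.
Qed.

(** Only real parts are compared, because the estimates see nothing else of the inner product. *)
Definition adjoint_ops (T U : finType) (F : (T -> C) -> U -> C)
    (G : (U -> C) -> T -> C) :=
  forall u v, rdot (F u) v = rdot u (G v).

(** Here [F] is an isometry with adjoint [G], so [F G] is a projection, and the inequality is
    [|v - F (G v)|^2 >= 0]. *)
Lemma coisometry_le (T U : finType) (F : (T -> C) -> U -> C)
    (G : (U -> C) -> T -> C) :
  adjoint_ops F G -> (forall u, G (F u) = u) ->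
  forall v, rdot (G v) (G v) <= rdot v v.
Proof.
move=> FG GF v; have := rdot_quad 1 v (F (G v)).
rewrite expr1n (rdotC v) !FG GF; lra.
Qed.

Lemma isometry_eq (T U : finType) (F : (T -> C) -> U -> C)
    (G : (U -> C) -> T -> C) :
  adjoint_ops F G -> (forall u, G (F u) = u) ->
  forall v, rdot (F v) (F v) = rdot v v.
Proof. by move=> FG GF v; rewrite FG GF. Qed.

(** The hypothesis on [Q P Q] gives [|P Q v| = e |Q v|], so [P Q] has norm at most [e]. The bound is
    [|e u - P (Q v)|^2 >= 0] divided by [e]. *)
Lemma overlap_bound (T : finType) (P Q : (T -> C) -> T -> C) (e : R) :
  0 < e -> adjoint_ops P P -> adjoint_ops Q Q ->
  (forall v, P (P v) = P v) -> (forall v, Q (Q v) = Q v) ->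
  (forall v, Q (P (Q v)) = fun t => (e ^+ 2)%:C * Q v t) ->
  forall u v, 2 * rdot (P u) (Q v) <= e * (rdot u u + rdot v v).
Proof.
move=> e0 PP QQ Pi Qi QPQ u v; rewrite PP.
have H1 := rdot_quad e u (P (Q v)).
have E0 : rdot v (Q v) = rdot (Q v) (Q v) by rewrite QQ Qi.
have Qv : rdot (Q v) (Q v) <= rdot v v.
  have := rdot_quad 1 v (Q v); rewrite expr1n E0; lra.
have E : rdot (P (Q v)) (P (Q v)) = e ^+ 2 * rdot (Q v) (Q v).
  rewrite PP Pi QQ QPQ -E0 /rdot /dot !Re_sum mulr_sumr.
  apply: eq_bigr => t _; case: (Q v t) (v t) => [a b] [a' b'] /=; ring.
move: H1; rewrite E => H1.
have H2 : e ^+ 2 * rdot (Q v) (Q v) <= e ^+ 2 * rdot v v.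
  by rewrite ler_pM2l // exprn_gt0.
have : 0 <= e * (e * (rdot u u + rdot v v) - 2 * rdot u (P (Q v))) by lra.
by rewrite pmulr_rge0 // subr_ge0.
Qed.

End InnerProduct.

(** * Operators on one or two of three registers *)

Section LocalOperators.
Variable R : realType.
Local Notation C := R[i].

Lemma sum_triple (V : nmodType) (X Y Z : finType) (F : X * Y * Z -> V) :
  \sum_p F p = \sum_x \sum_y \sum_z F (x, y, z).
Proof. by rewrite pair_bigA pair_bigA; apply: eq_bigr => -[[x y] z]. Qed.

(** Operators are kernels on finite types, output index first, so that registers are split and
    regrouped by pairing instead of index arithmetic. *)
Definition adjk (S T : finType) (E : S -> T -> C) : T -> S -> C :=
  fun t s => Num.conj (E s t).

Definition isometryk (S T : finType) (E : S -> T -> C) : Prop :=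
  forall t t', \sum_s Num.conj (E s t) * E s t' = (t == t')%:R.

Definition opA (X Y Y' Z : finType) (E : Y' -> Y -> C) (v : X * Y * Z -> C) :
    X * Y' * Z -> C :=
  fun p => \sum_y E p.1.2 y * v (p.1.1, y, p.2).

Definition opB (X Y Z Z' : finType) (F : Z' -> Z -> C) (v : X * Y * Z -> C) :
    X * Y * Z' -> C :=
  fun p => \sum_z F p.2 z * v (p.1, z).

(** [K] is the environment of Alice's dilated channel, and [L] below that of Bob's. The projections
    act on the qubits only and leave both environments untouched. *)
Definition opRA (X A K Z : finType) (p : X * A -> X * A -> C)
    (v : X * (A * K) * Z -> C) : X * (A * K) * Z -> C :=
  fun t => \sum_x \sum_a p (t.1.1, t.1.2.1) (x, a) * v (x, (a, t.1.2.2), t.2).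

Definition opRB (X B L Y : finType) (p : X * B -> X * B -> C)
    (v : X * Y * (B * L) -> C) : X * Y * (B * L) -> C :=
  fun t => \sum_x \sum_b p (t.1.1, t.2.1) (x, b) * v (x, t.1.2, (b, t.2.2)).

Definition opRAB (X A B K L : finType) (M : X * A * B -> X * A * B -> C)
    (v : X * (A * K) * (B * L) -> C) : X * (A * K) * (B * L) -> C :=
  fun t => \sum_q M (t.1.1, t.1.2.1, t.2.1) q *
    v (q.1.1, (q.1.2, t.1.2.2), (q.2, t.2.2)).

Lemma opA_adjoint (X Y Y' Z : finType) (E : Y' -> Y -> C) :
  adjoint_ops (@opA X Y Y' Z E) (opA (adjk E)).
Proof.
move=> u v; congr complex.Re; rewrite /dot !sum_triple; apply: eq_bigr => x _.
under eq_bigr => y _ do under eq_bigr => z _ do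
  rewrite /opA /= rmorph_sum mulr_suml.
under [RHS]eq_bigr => y _ do under eq_bigr => z _ do rewrite /opA /= mulr_sumr.
rewrite exchange_big /= [RHS]exchange_big; apply: eq_bigr => z _ /=.
rewrite exchange_big; apply: eq_bigr => y _; apply: eq_bigr => y' _.
by rewrite rmorphM /= /adjk mulrCA mulrA.
Qed.

Lemma opB_adjoint (X Y Z Z' : finType) (F : Z' -> Z -> C) :
  adjoint_ops (@opB X Y Z Z' F) (opB (adjk F)).
Proof.
move=> u v; congr complex.Re; rewrite /dot !sum_triple.
apply: eq_bigr => x _; apply: eq_bigr => y _.
under eq_bigr => z _ do rewrite /opB /= rmorph_sum mulr_suml.
under [RHS]eq_bigr => z _ do rewrite /opB /= mulr_sumr.
rewrite exchange_big; apply: eq_bigr => z _; apply: eq_bigr => z' _.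
by rewrite rmorphM /= /adjk mulrCA mulrA.
Qed.

Lemma opA_isometry (X Y Y' Z : finType) (E : Y' -> Y -> C) :
  isometryk E -> forall v : X * Y * Z -> C, opA (adjk E) (opA E v) = v.
Proof.
move=> HE v; apply/funext => -[[x y] z]; rewrite /opA /=.
under eq_bigr => y' _ do rewrite mulr_sumr.
rewrite exchange_big (bigD1 y) //= [X in _ + X]big1 ?addr0 => [|y' /negPf ny].
  under eq_bigr => y' _ do rewrite mulrA.
  by rewrite -mulr_suml HE eqxx mul1r.
under eq_bigr => y'' _ do rewrite mulrA.
by rewrite -mulr_suml HE eq_sym ny mul0r.
Qed.

Lemma opB_isometry (X Y Z Z' : finType) (F : Z' -> Z -> C) :
  isometryk F -> forall v : X * Y * Z -> C, opB (adjk F) (opB F v) = v.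
Proof.
move=> HF v; apply/funext => -[[x y] z]; rewrite /opB /=.
under eq_bigr => y' _ do rewrite mulr_sumr.
rewrite exchange_big (bigD1 z) //= [X in _ + X]big1 ?addr0 => [|y' /negPf ny].
  under eq_bigr => y' _ do rewrite mulrA.
  by rewrite -mulr_suml HF eqxx mul1r.
under eq_bigr => y'' _ do rewrite mulrA.
by rewrite -mulr_suml HF eq_sym ny mul0r.
Qed.

Lemma opA_opB (X Y Y' Z Z' : finType) (E : Y' -> Y -> C) (F : Z' -> Z -> C)
    (v : X * Y * Z -> C) :
  opA E (opB F v) = opB F (opA E v).
Proof.
apply/funext => -[[x y] z]; rewrite /opA /opB /=.
under eq_bigr do rewrite mulr_sumr.
under [RHS]eq_bigr do rewrite mulr_sumr.
rewrite exchange_big; apply: eq_bigr => a _; apply: eq_bigr => b _.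
exact: mulrCA.
Qed.

Lemma opRA_opB (X A K Z Z' : finType) (p : X * A -> X * A -> C)
    (F : Z' -> Z -> C) (v : X * (A * K) * Z -> C) :
  opRA p (opB F v) = opB F (opRA p v).
Proof.
apply/funext => -[[x [a k]] z]; rewrite /opRA /opB /=.
under [RHS]eq_bigr do rewrite mulr_sumr.
rewrite [RHS]exchange_big; apply: eq_bigr => x' _ /=.
under [RHS]eq_bigr do rewrite mulr_sumr.
rewrite [RHS]exchange_big; apply: eq_bigr => a' _ /=.
by rewrite mulr_sumr; apply: eq_bigr => z' _; rewrite mulrCA.
Qed.

Lemma opRB_opA (X B L Y Y' : finType) (p : X * B -> X * B -> C)
    (E : Y' -> Y -> C) (v : X * Y * (B * L) -> C) :
  opRB p (opA E v) = opA E (opRB p v).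
Proof.
apply/funext => -[[x y] [b l]]; rewrite /opRB /opA /=.
under [RHS]eq_bigr do rewrite mulr_sumr.
rewrite [RHS]exchange_big; apply: eq_bigr => x' _ /=.
under [RHS]eq_bigr do rewrite mulr_sumr.
rewrite [RHS]exchange_big; apply: eq_bigr => a' _ /=.
by rewrite mulr_sumr; apply: eq_bigr => z' _; rewrite mulrCA.
Qed.

Definition mulk (T : finType) (M N : T -> T -> C) : T -> T -> C :=
  fun s t => \sum_q M s q * N q t.

Lemma opRAB_comp (X A B K L : finType) (M N : X * A * B -> X * A * B -> C)
    (v : X * (A * K) * (B * L) -> C) :
  opRAB M (opRAB N v) = opRAB (mulk M N) v.
Proof.
apply/funext => -[[x [a k]] [b l]]; rewrite /opRAB /mulk /=.
under eq_bigr do rewrite mulr_sumr.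
under [RHS]eq_bigr do rewrite mulr_suml.
rewrite exchange_big; apply: eq_bigr => q _; apply: eq_bigr => s _ /=.
by rewrite -surjective_pairing -surjective_pairing mulrA.
Qed.

(** With the environment indices outermost, [opRAB] acts on each block of fixed [k] and [l] as the
    bare kernel. *)
Lemma sum_env (V : nmodType) (X A B K L : finType)
    (G : X * (A * K) * (B * L) -> V) :
  \sum_t G t = \sum_(k : K) \sum_(l : L) \sum_(q : X * A * B)
    G (q.1.1, (q.1.2, k), (q.2, l)).
Proof.
pose h (t : X * A * B * (K * L)) : X * (A * K) * (B * L) :=
  (t.1.1.1, (t.1.1.2, t.2.1), (t.1.2, t.2.2)).
have hbij : bijective h.
  exists (fun t => (t.1.1, t.1.2.1, t.2.1, (t.1.2.2, t.2.2))).
    by case=> [[[x a] b] [k l]].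
  by case=> [[x [a k]] [b l]].
rewrite pair_bigA exchange_big pair_bigA (reindex h) /=; last exact: onW_bij.
by apply: eq_bigr => -[[[x a] b] [k l]].
Qed.

Lemma opRAB_adjoint (X A B K L : finType) (M : X * A * B -> X * A * B -> C) :
  adjoint_ops (@opRAB X A B K L M) (opRAB (adjk M)).
Proof.
move=> u v; congr complex.Re; rewrite /dot !sum_env.
apply: eq_bigr => k _; apply: eq_bigr => l _; rewrite /opRAB /=.
under eq_bigr => q _ do rewrite rmorph_sum mulr_suml.
under [RHS]eq_bigr => q _ do rewrite mulr_sumr.
rewrite exchange_big; apply: eq_bigr => -[[x a] b] _.
apply: eq_bigr => -[[x' a'] b'] _ /=.
by rewrite rmorphM /= /adjk mulrCA mulrA.
Qed.

(** The same operator gets two forms: [opRAB] composes through [mulk], whereas [opRA] is indifferent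
    to the type of Bob's register and so commutes with [opB]. *)
Lemma opRAB_opRA (X A B K L : finType) (M : X * A * B -> X * A * B -> C)
    (p : X * A -> X * A -> C) :
  (forall s t, M s t = p s.1 t.1 * (s.2 == t.2)%:R) ->
  forall v : X * (A * K) * (B * L) -> C, opRAB M v = opRA p v.
Proof.
move=> HM v; apply/funext => -[[x [a k]] [b l]].
rewrite /opRAB /opRA sum_triple /=.
apply: eq_bigr => x' _; apply: eq_bigr => a' _.
rewrite (bigD1 b) //= HM /= eqxx mulr1 big1 ?addr0 // => b' /negPf nb.
by rewrite HM /= eq_sym nb mulr0 mul0r.
Qed.

Lemma opRAB_opRB (X A B K L : finType) (M : X * A * B -> X * A * B -> C)
    (p : X * B -> X * B -> C) :
  (forall s t, M s t = p (s.1.1, s.2) (t.1.1, t.2) * (s.1.2 == t.1.2)%:R) ->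
  forall v : X * (A * K) * (B * L) -> C, opRAB M v = opRB p v.
Proof.
move=> HM v; apply/funext => -[[x [a k]] [b l]].
rewrite /opRAB /opRB sum_triple /=.
apply: eq_bigr => x' _; rewrite exchange_big; apply: eq_bigr => b' _ /=.
rewrite (bigD1 a) //= HM /= eqxx mulr1 big1 ?addr0 // => a' /negPf na.
by rewrite HM /= eq_sym na mulr0 mul0r.
Qed.

(* [P] acts on R A and [Q] on R B, so [P] slides past Bob's maps and [Q] past
   Alice's; what remains between [P] and [Q] is a pair of contractions. *)
Lemma crossed_overlap (X A B K L Y Z : finType)
    (P Q : X * A * B -> X * A * B -> C)
    (p : X * A -> X * A -> C) (q : X * B -> X * B -> C) (e : R)
    (E E' : A * K -> Y -> C) (F F' : B * L -> Z -> C) :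
  0 < e ->
  (forall s t, P s t = p s.1 t.1 * (s.2 == t.2)%:R) ->
  (forall s t, Q s t = q (s.1.1, s.2) (t.1.1, t.2) * (s.1.2 == t.1.2)%:R) ->
  adjk P = P -> adjk Q = Q -> mulk P P = P -> mulk Q Q = Q ->
  mulk Q (mulk P Q) = (fun s t => (e ^+ 2)%:C * Q s t) ->
  isometryk E -> isometryk E' -> isometryk F -> isometryk F' ->
  forall u v : X * (A * K) * (B * L) -> C,
  opRAB P u = u -> opRAB Q v = v ->
  2 * rdot (opA (adjk E) (opB (adjk F) u)) (opA (adjk E') (opB (adjk F') v))
    <= e * (rdot u u + rdot v v).
Proof.
move=> e0 HP HQ Pa Qa PP QQ QPQ iE iE' iF iF' u v Pu Qv.
(* [F'] and [E] are taken from the other side of the inner product: [<E^* F^* u, E'^* F'^* v> = <F'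
   F^* u, E E'^* v>]. On the left only Bob's maps remain, which commute with [P]; on the right only
   Alice's, which commute with [Q]. *)
set u2 := opB F' (opB (adjk F) u).
set v2 := opA E (opA (adjk E') v).
have u2u : rdot u2 u2 <= rdot u u.
  rewrite /u2 (isometry_eq (@opB_adjoint _ _ _ _ F') (opB_isometry iF')).
  exact: (coisometry_le (@opB_adjoint _ _ _ _ F) (opB_isometry iF)).
have v2v : rdot v2 v2 <= rdot v v.
  rewrite /v2 (isometry_eq (@opA_adjoint _ _ _ _ E) (opA_isometry iE)).
  exact: (coisometry_le (@opA_adjoint _ _ _ _ E') (opA_isometry iE')).
have -> : rdot (opA (adjk E) (opB (adjk F) u))
    (opA (adjk E') (opB (adjk F') v)) = rdot (opRAB P u2) (opRAB Q v2).
  rewrite [in RHS](opRAB_opRA HP) [in RHS](opRAB_opRB HQ).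
  rewrite /u2 /v2 !opRA_opB !opRB_opA -(opRAB_opRA HP) -(opRAB_opRB HQ) Pu Qv.
  rewrite [RHS]rdotC [in RHS]opA_adjoint [RHS]rdotC [in RHS]opA_opB.
  by rewrite [RHS]opB_adjoint -[in RHS]opA_opB.
have := overlap_bound e0 (P := @opRAB X A B K L P) (Q := @opRAB X A B K L Q).
rewrite /adjoint_ops => /(_ _ _ _ _ _ u2 v2) H.
apply: (le_trans (H _ _ _ _ _)).
- by move=> f g; rewrite opRAB_adjoint Pa.
- by move=> f g; rewrite opRAB_adjoint Qa.
- by move=> f; rewrite opRAB_comp PP.
- by move=> f; rewrite opRAB_comp QQ.
- move=> f; rewrite (opRAB_comp P Q) (opRAB_comp Q) QPQ; apply/funext => t.
  by rewrite /opRAB mulr_sumr; apply: eq_bigr => s _; rewrite mulrA.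
by rewrite ler_pM2l // lerD.
Qed.

End LocalOperators.

(** * The projections of a single copy *)

Section Qubits.
Variable R : realType.
Local Notation C := R[i].
Variable n : nat.

Lemma ord2P (P : 'I_2 -> Prop) : P 0 -> P 1 -> forall c, P c.
Proof.
move=> P0 P1 [[|[|//]] h].
  by have -> : Ordinal h = 0 by apply/val_inj.
by have -> : Ordinal h = 1 by apply/val_inj.
Qed.

Definition at_copy (p : bits3 n) (i : 'I_n) : qubits3 := (p.1.1 i, p.1.2 i, p.2 i).

(** Three bit strings amount to one string of qubit triples, so distributivity applies. This reduces
    every computation on [n] copies to a single copy. *)
Lemma big_bits3 (F : 'I_n -> qubits3 -> C) :
  \sum_(p : bits3 n) \prod_i F i (at_copy p i) = \prod_i \sum_t F i t.
Proof.
rewrite bigA_distr_bigA /=.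
pose h (p : bits3 n) : {ffun 'I_n -> qubits3} := [ffun i => at_copy p i].
have hbij : bijective h.
  exists (fun f : {ffun 'I_n -> qubits3} =>
    ([ffun i => (f i).1.1], [ffun i => (f i).1.2], [ffun i => (f i).2])).
    by case=> [[r a] b]; congr (_, _, _); apply/ffunP => i; rewrite !ffunE.
  by move=> f; apply/ffunP => i; rewrite !ffunE /at_copy /= !ffunE; case: (f i) => [[]].
rewrite [RHS](reindex h) /=; last exact: onW_bij.
by apply: eq_bigr => p _; apply: eq_bigr => i _; rewrite ffunE.
Qed.

Definition prodk (m : 'I_n -> qubits3 -> qubits3 -> C) : bits3 n -> bits3 n -> C :=
  fun s t => \prod_i m i (at_copy s i) (at_copy t i).

Lemma mulk_prodk (m m' : 'I_n -> qubits3 -> qubits3 -> C) :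
  mulk (prodk m) (prodk m') = prodk (fun i => mulk (m i) (m' i)).
Proof.
apply/funext => s; apply/funext => t; rewrite /mulk /prodk.
rewrite -(big_bits3 (fun i q => m i (at_copy s i) q * m' i q (at_copy t i))).
by apply: eq_bigr => q _; rewrite -big_split.
Qed.

Lemma adjk_prodk (m : 'I_n -> qubits3 -> qubits3 -> C) :
  adjk (prodk m) = prodk (fun i => adjk (m i)).
Proof.
by apply/funext => s; apply/funext => t; rewrite /adjk /prodk rmorph_prod.
Qed.

Definition qubit_Q (c : 'I_2) (s : qubits3) : 'I_2 :=
  if c == 0 then s.1.2 else s.2.

Definition local_proj (c : 'I_2) (s t : qubits3) : C :=
  phi_plus_proj C (mxtens_index (s.1.1, qubit_Q c s))
                  (mxtens_index (t.1.1, qubit_Q c t))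
  * (1%:M : 'M[C]_2) (qubit_Q (1 - c) s) (qubit_Q (1 - c) t).

Lemma phi_plus_projE (a b a' b' : 'I_2) :
  phi_plus_proj C (mxtens_index (a, b)) (mxtens_index (a', b')) =
  2^-1 * (a == b)%:R * (a' == b')%:R.
Proof.
have phiE (x y : 'I_2) j : phi_plus C (mxtens_index (x, y)) j =
    (sqrtC 2)^-1 * (x == y)%:R.
  rewrite !mxE mxtens_indexK !ord1 !eqxx !andbT; congr (_ * _).
  by elim/ord2P: x; elim/ord2P: y; rewrite /= ?(mulr0, mulr1) ?(addr0, add0r).
rewrite /phi_plus_proj mxE big_ord1 phiE [X in _ * X]mxE [X in _ * _ X]mxE phiE.
rewrite rmorphM /= conjC_nat fmorphV /= conj_Creal ?ger0_real ?sqrtC_ge0 //.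
rewrite mulrACA -invfM -expr2 sqrtCK; ring.
Qed.

Lemma local_proj0E (s t : qubits3) : local_proj 0 s t =
  2^-1 * (s.1.1 == s.1.2)%:R * (t.1.1 == t.1.2)%:R * (s.2 == t.2)%:R.
Proof. by rewrite /local_proj phi_plus_projE mxE. Qed.

Lemma local_proj1E (s t : qubits3) : local_proj 1 s t =
  2^-1 * (s.1.1 == s.2)%:R * (t.1.1 == t.2)%:R * (s.1.2 == t.1.2)%:R.
Proof. by rewrite /local_proj phi_plus_projE mxE. Qed.

Lemma local_proj_adj (c : 'I_2) : adjk (local_proj c) = local_proj c.
Proof.
apply/funext => s; apply/funext => t; rewrite /adjk; elim/ord2P: c.
  rewrite !local_proj0E !rmorphM /= fmorphV /= !conjC_nat.
  by rewrite (eq_sym t.2); ring.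
rewrite !local_proj1E !rmorphM /= fmorphV /= !conjC_nat.
by rewrite (eq_sym t.1.2); ring.
Qed.

Lemma sum_qubits3 (F : qubits3 -> C) : \sum_p F p =
  F (0, 0, 0) + F (0, 0, 1) + (F (0, 1, 0) + F (0, 1, 1)) +
  (F (1, 0, 0) + F (1, 0, 1) + (F (1, 1, 0) + F (1, 1, 1))).
Proof.
have E1 : lift ord0 ord0 = 1 :> 'I_2 by apply/val_inj.
by rewrite sum_triple !big_ord_recl !big_ord0 E1 !addr0.
Qed.

Lemma local_proj_idem (c : 'I_2) : mulk (local_proj c) (local_proj c) = local_proj c.
Proof.
apply/funext => -[[r a] b]; apply/funext => -[[r' a'] b'].
rewrite /mulk sum_qubits3; elim/ord2P: c.
  rewrite !local_proj0E /=.
  by elim/ord2P: r; elim/ord2P: a; elim/ord2P: b;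
     elim/ord2P: r'; elim/ord2P: a'; elim/ord2P: b' => /=; field.
rewrite !local_proj1E /=.
by elim/ord2P: r; elim/ord2P: a; elim/ord2P: b;
   elim/ord2P: r'; elim/ord2P: a'; elim/ord2P: b' => /=; field.
Qed.

(** The product is one half of [|Phi+>_RA <Phi+|_RB] combined with the transport of the input qubit
    A to the output qubit B. This closed form leaves a single sum of eight terms in the triple
    product that follows. *)
Lemma local_proj01 (s t : qubits3) : mulk (local_proj 0) (local_proj 1) s t =
  4^-1 * (s.1.1 == s.1.2)%:R * (t.1.2 == s.2)%:R * (t.1.1 == t.2)%:R.
Proof.
case: s => [[r a] b]; case: t => [[r' a'] b'].
rewrite /mulk sum_qubits3 !local_proj0E !local_proj1E /=.
by elim/ord2P: r; elim/ord2P: a; elim/ord2P: b;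
   elim/ord2P: r'; elim/ord2P: a'; elim/ord2P: b' => /=; field.
Qed.

(** The factor [1 / 4] is the squared norm of the product of the two projections: each crossed copy
    costs a factor [1 / 2] in norm. *)
Lemma local_proj101 :
  mulk (local_proj 1) (mulk (local_proj 0) (local_proj 1)) =
  (fun s t => 4^-1 * local_proj 1 s t).
Proof.
apply/funext => -[[r a] b]; apply/funext => -[[r' a'] b'].
rewrite {1}/mulk sum_qubits3 !local_proj01 !local_proj1E /=.
by elim/ord2P: r; elim/ord2P: a; elim/ord2P: b;
   elim/ord2P: r'; elim/ord2P: a'; elim/ord2P: b' => /=; field.
Qed.

Lemma mul1k (T : finType) (M : T -> T -> C) : mulk (fun s t => (s == t)%:R) M = M.
Proof.
apply/funext => s; apply/funext => t; rewrite /mulk (bigD1 s) //= eqxx mul1r.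
by rewrite big1 ?addr0 // => q /negPf nq; rewrite eq_sym nq mul0r.
Qed.

End Qubits.

(** * Overlap of the winning projections *)

Section Overlap.
Variable R : realType.
Local Notation C := R[i].
Variable n : nat.

Definition winningk (x : bits n) : bits3 n -> bits3 n -> C :=
  prodk (fun i => local_proj R (x i)).

Definition partial_proj (c : 'I_2) (S : pred 'I_n) : bits3 n -> bits3 n -> C :=
  prodk (fun i => if S i then local_proj R c else (fun s t => (s == t)%:R)).

Lemma winningk_adj x : adjk (winningk x) = winningk x.
Proof.
by rewrite adjk_prodk; congr prodk; apply/funext => i; rewrite local_proj_adj.
Qed.

Lemma winningk_idem x : mulk (winningk x) (winningk x) = winningk x.
Proof.
by rewrite mulk_prodk; congr prodk; apply/funext => i; rewrite local_proj_idem.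
Qed.

Lemma partial_proj_adj c S : adjk (partial_proj c S) = partial_proj c S.
Proof.
rewrite adjk_prodk; congr prodk; apply/funext => i.
case: ifP => _; first exact: local_proj_adj.
by apply/funext => s; apply/funext => t; rewrite /adjk conjC_nat eq_sym.
Qed.

Lemma partial_proj_idem c S :
  mulk (partial_proj c S) (partial_proj c S) = partial_proj c S.
Proof.
rewrite mulk_prodk; congr prodk; apply/funext => i.
by case: ifP => _; [exact: local_proj_idem | exact: mul1k].
Qed.

(** On [S] the two factors coincide and are idempotent; elsewhere the partial projection is the
    identity. Hence vectors fixed by a winning projection are fixed by the partial one. *)
Lemma partial_proj_winningk c (S : pred 'I_n) (x : bits n) :
  (forall i, S i -> x i = c) ->
  mulk (partial_proj c S) (winningk x) = winningk x.
Proof.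
move=> Sx; rewrite mulk_prodk; congr prodk; apply/funext => i.
by case: ifP => [/Sx ->|_]; [exact: local_proj_idem | exact: mul1k].
Qed.

Definition half_power (S : pred 'I_n) : R := \prod_i (if S i then 2^-1 else 1).

Lemma half_power_gt0 S : 0 < half_power S.
Proof. by apply: prodr_gt0 => i _; case: ifP => _; lra. Qed.

Lemma partial_proj101 S :
  mulk (partial_proj 1 S) (mulk (partial_proj 0 S) (partial_proj 1 S)) =
  (fun s t => (half_power S ^+ 2)%:C * partial_proj 1 S s t).
Proof.
rewrite !mulk_prodk; apply/funext => s; apply/funext => t.
rewrite /half_power -prodrXl rmorph_prod -big_split /=.
apply: eq_bigr => i _; case: ifP => _.
  rewrite local_proj101; congr (_ * _).
  by rewrite rmorphXn /= fmorphV /= rmorph_nat; field.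
by rewrite !mul1k expr1n mul1r.
Qed.

(** This form lets an identity on a whole register be split off copy by copy. *)
Lemma eq_bits_prod (s t : bits n) : (s == t)%:R = \prod_i (s i == t i)%:R :> C.
Proof.
case: eqP => [->|/eqP st]; first by rewrite big1 // => i _; rewrite eqxx.
have /existsP[i si] : [exists i, s i != t i].
  apply: contraR st => /existsPn H; apply/eqP/ffunP => i.
  by have := H i; rewrite negbK => /eqP.
by rewrite (bigD1 i) //= (negPf si) mul0r.
Qed.

(** Exhibits a kernel on R A alone times the identity on B, the form in which the projection passes
    Bob's maps. *)
Lemma partial_proj0_local S (s t : bits3 n) : partial_proj 0 S s t =
  \prod_i (if S i then 2^-1 * (s.1.1 i == s.1.2 i)%:R * (t.1.1 i == t.1.2 i)%:R
           else (s.1.1 i == t.1.1 i)%:R * (s.1.2 i == t.1.2 i)%:R)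
  * (s.2 == t.2)%:R.
Proof.
rewrite eq_bits_prod -big_split; apply: eq_bigr => i _ /=; case: ifP => _.
  exact: local_proj0E.
by rewrite /at_copy -!natrM !mulnb !xpair_eqE.
Qed.

Lemma partial_proj1_local S (s t : bits3 n) : partial_proj 1 S s t =
  \prod_i (if S i then 2^-1 * (s.1.1 i == s.2 i)%:R * (t.1.1 i == t.2 i)%:R
           else (s.1.1 i == t.1.1 i)%:R * (s.2 i == t.2 i)%:R)
  * (s.1.2 == t.1.2)%:R.
Proof.
rewrite eq_bits_prod -big_split; apply: eq_bigr => i _ /=; case: ifP => _.
  exact: local_proj1E.
by rewrite /at_copy -!natrM !mulnb !xpair_eqE /= andbAC.
Qed.

(** * Weights of the Schur test *)

Definition overlap (x y : bits n) : R :=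
  \prod_i (if x i == y i then 1 else (Num.sqrt 2)^-1).

Lemma sqrt2V_gt0 : 0 < (Num.sqrt 2)^-1 :> R.
Proof. by rewrite invr_gt0 sqrtr_gt0. Qed.

Lemma sqrt2V_sqr : (Num.sqrt 2)^-1 ^+ 2 = 2^-1 :> R.
Proof. by rewrite exprVn sqr_sqrtr. Qed.

Lemma overlapC x y : overlap x y = overlap y x.
Proof. by apply: eq_bigr => i _; rewrite eq_sym. Qed.

Lemma overlap_gt0 x y : 0 < overlap x y.
Proof. by apply: prodr_gt0 => i _; case: ifP => // _; rewrite sqrt2V_gt0. Qed.

(** The weights factor over positions, and each position contributes [1] for the agreeing bit and
    [1 / sqrt 2] for the other. *)
Lemma overlap_sum x : \sum_y overlap x y = (1 + (Num.sqrt 2)^-1) ^+ n.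
Proof.
rewrite -(bigA_distr_bigA (fun i b => if x i == b then 1 else (Num.sqrt 2)^-1)).
rewrite -[in RHS](card_ord n) -prodr_const; apply: eq_bigr => i _.
rewrite 2!big_ord_recl big_ord0 /= addr0.
have -> : lift ord0 ord0 = 1 :> 'I_2 by apply/val_inj.
by elim/ord2P: (x i) => //=; rewrite addrC.
Qed.

Definition cross (x y : bits n) : pred 'I_n :=
  fun i => (x i == 0) && (y i == 1).

(** Each position where [x] and [y] differ lies in exactly one of the two crossed sets, so the two
    half powers multiply to the square of [overlap x y] and cannot both exceed it. *)
Lemma half_power_cross x y :
  half_power (cross x y) <= overlap x y \/ half_power (cross y x) <= overlap x y.
Proof.
have E : half_power (cross x y) * half_power (cross y x) = overlap x y * overlap x y.
  rewrite /half_power /overlap -!big_split; apply: eq_bigr => i _ /=.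
  rewrite /cross; elim/ord2P: (x i); elim/ord2P: (y i) => /=;
    by rewrite -?expr2 ?sqrt2V_sqr ?expr2 ?mulr1 ?mul1r.
case: (leP (half_power (cross x y)) (overlap x y)); first by left.
move=> H1; right; rewrite leNgt; apply/negP => H2.
have := ltr_pM (ltW (overlap_gt0 x y)) (ltW (overlap_gt0 x y)) H1 H2.
by rewrite E ltxx.
Qed.

Variables (K L Y Z : finType).
Variables (E : bits n -> bits n * K -> Y -> C) (F : bits n -> bits n * L -> Z -> C).
Hypotheses (iE : forall x, isometryk (E x)) (iF : forall x, isometryk (F x)).

Lemma cross_overlap x y (u v : bits n * (bits n * K) * (bits n * L) -> C) :
  opRAB (winningk x) u = u -> opRAB (winningk y) v = v ->
  2 * rdot (opA (adjk (E x)) (opB (adjk (F x)) u))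
           (opA (adjk (E y)) (opB (adjk (F y)) v))
    <= half_power (cross x y) * (rdot u u + rdot v v).
Proof.
move=> Wu Wv; set S := cross x y.
pose p (s t : bits n * bits n) : C :=
  \prod_i (if S i then 2^-1 * (s.1 i == s.2 i)%:R * (t.1 i == t.2 i)%:R
           else (s.1 i == t.1 i)%:R * (s.2 i == t.2 i)%:R).
apply: (@crossed_overlap R _ _ _ K L Y Z
  (partial_proj 0 S) (partial_proj 1 S) p p) => //.
- exact: half_power_gt0.
- exact: partial_proj0_local.
- exact: partial_proj1_local.
- exact: partial_proj_adj.
- exact: partial_proj_adj.
- exact: partial_proj_idem.
- exact: partial_proj_idem.
- exact: partial_proj101.
- by rewrite -Wu opRAB_comp partial_proj_winningk // => i /andP[/eqP].
- by rewrite -Wv opRAB_comp partial_proj_winningk // => i /andP[_ /eqP].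
Qed.

(** The Schur test for the vectors [T_x^* u_x]. As [psi] may have any norm, the bound can be summed
    over the pure components of a mixed state. *)
Lemma sum_winningk_le (psi : bits n * Y * Z -> C) :
  \sum_x rdot (opA (E x) (opB (F x) psi))
              (opRAB (winningk x) (opA (E x) (opB (F x) psi)))
  <= (1 + (Num.sqrt 2)^-1) ^+ n * rdot psi psi.
Proof.
pose u x := opRAB (winningk x) (opA (E x) (opB (F x) psi)).
have Wu x : opRAB (winningk x) (u x) = u x.
  by rewrite /u opRAB_comp winningk_idem.
have uu x : rdot (u x) (u x) =
    rdot (opA (E x) (opB (F x) psi)) (opRAB (winningk x) (opA (E x) (opB (F x) psi))).
  by rewrite {1}/u opRAB_adjoint winningk_adj Wu.
rewrite -(eq_bigr _ (fun x _ => uu x)).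
apply: (gram_bound (w := fun x => opA (adjk (E x)) (opB (adjk (F x)) (u x)))
  (c := overlap)).
- by rewrite exprn_gt0 // addr_gt0 // sqrt2V_gt0.
- exact: overlapC.
- exact: overlap_sum.
- by move=> x; rewrite opA_opB -opB_adjoint -opA_adjoint uu.
move=> x y; have le_uu := addr_ge0 (rdot_ge0 (u x)) (rdot_ge0 (u y)).
(* The crossing estimate is asymmetric in [x] and [y]; the symmetry of [rdot] allows whichever order
   gives the smaller constant. *)
case: (half_power_cross x y) => H.
  by apply: (le_trans (cross_overlap (Wu x) (Wu y))); rewrite ler_wpM2r.
rewrite rdotC; apply: (le_trans (cross_overlap (Wu y) (Wu x))).
by rewrite [rdot _ _ + _]addrC ler_wpM2r.
Qed.

End Overlap.

(** * Positive semidefinite matrices and Kraus operators *)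

Section PositiveSemidefinite.
Variable C : numClosedFieldType.

Lemma psdmx_form n (A : 'M[C]_n) (v : 'I_n -> C) : psdmx A ->
  0 <= \sum_i \sum_j Num.conj (v i) * A i j * v j.
Proof.
move=> /(_ (\col_i v i)); congr (0 <= _).
rewrite mxE exchange_big; apply: eq_bigr => j _; rewrite !mxE mulr_suml.
by apply: eq_bigr => i _; rewrite !mxE.
Qed.

Lemma psdmxP n (A : 'M[C]_n) :
  (forall v : 'I_n -> C, 0 <= \sum_i \sum_j Num.conj (v i) * A i j * v j) ->
  psdmx A.
Proof.
move=> H v; have := H (fun i => v i 0); congr (0 <= _).
rewrite mxE exchange_big; apply: eq_bigr => j _; rewrite !mxE mulr_suml.
by apply: eq_bigr => i _; rewrite !mxE.
Qed.

(** Polarisation: the form is real at [e_i + c e_j]. Taking [c = 1] makes [A i j + A j i] real, and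
    [c = 'i] makes ['i * (A i j - A j i)] real. This opens the way to the spectral theorem. *)
Lemma psdmx_conj n (A : 'M[C]_n) : psdmx A -> forall i j, A i j = Num.conj (A j i).
Proof.
move=> Apsd i j.
have form2 (c : C) :
    A i i + c * A i j + (Num.conj c * A j i + `|c| ^+ 2 * A j j) \is Num.real.
  apply: ger0_real.
  have := psdmx_form (fun k => (k == i)%:R + c * (k == j)%:R) Apsd.
  have sum_delta (G : 'I_n -> C) : \sum_k ((k == i)%:R + c * (k == j)%:R) * G k =
      G i + c * G j.
    under eq_bigr do rewrite mulrDl -mulrA.
    rewrite big_split /= -mulr_sumr; congr (_ + c * _).
      by rewrite (bigD1 i) //= eqxx mul1r big1 ?addr0 // => k /negPf->; rewrite mul0r.
    by rewrite (bigD1 j) //= eqxx mul1r big1 ?addr0 // => k /negPf->; rewrite mul0r.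
  have sum_deltaC (G : 'I_n -> C) :
      \sum_k Num.conj ((k == i)%:R + c * (k == j)%:R) * G k = G i + Num.conj c * G j.
    rewrite -[LHS]conjCK rmorph_sum.
    under eq_bigr do rewrite rmorphM /= conjCK.
    by rewrite sum_delta rmorphD rmorphM /= !conjCK.
  congr (0 <= _).
  under eq_bigr => k _ do under eq_bigr => l _ do rewrite -mulrA (mulrC (A k l)).
  under eq_bigr => k _ do rewrite -mulr_sumr sum_delta.
  rewrite sum_deltaC normCK; ring.
have real_A k : A k k \is Num.real.
  apply: ger0_real; have := psdmx_form (fun l => (l == k)%:R) Apsd.
  congr (0 <= _); rewrite (bigD1 k) //= (bigD1 k) //= eqxx conjC1 mul1r mulr1.
  rewrite !big1 ?addr0 // => l /negPf nl; last by rewrite nl mulr0.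
  by rewrite big1 // => m _; rewrite nl conjC0 !mul0r.
have H1 := form2 1; have H2 := form2 'i%R.
have {}H1 : A i j + A j i \is Num.real.
  have := rpredB H1 (rpredD (real_A i) (real_A j)).
  by congr (_ \is Num.real); rewrite normr1 conjC1 expr1n; ring.
have {}H2 : 'i%R * (A i j - A j i) \is Num.real.
  have := rpredB H2 (rpredD (real_A i) (real_A j)).
  by congr (_ \is Num.real); rewrite normCi conjCi expr1n; ring.
have E1 := conj_Creal H1; have E2 := conj_Creal H2.
rewrite rmorphD /= in E1; rewrite rmorphM rmorphB /= conjCi mulNr in E2.
have E3 : Num.conj (A j i) - Num.conj (A i j) = A i j - A j i.
  by apply: (mulfI (neq0Ci C)); rewrite -E2; ring.
have : 2 * A i j = 2 * Num.conj (A j i).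
  transitivity ((A i j + A j i) + (A i j - A j i)); first by ring.
  by rewrite -E1 -E3; ring.
by apply: mulfI; rewrite pnatr_eq0.
Qed.

(** Spectral theorem, with the square root of each eigenvalue absorbed into its eigenvector. It
    serves both for the shared state, as a mixture of unnormalised pure states, and for Choi
    matrices. *)
Lemma psdmx_decomp n (A : 'M[C]_n) : psdmx A ->
  exists v : 'I_n -> 'I_n -> C,
    forall i j, A i j = \sum_k v k i * Num.conj (v k j).
Proof.
move=> Apsd.
have Aherm : A \is hermsymmx.
  apply/is_hermitianmxP; rewrite expr0 scale1r; apply/matrixP => i j.
  by rewrite !mxE; exact: psdmx_conj.
have := orthomx_spectralP (hermitian_normalmx Aherm).
set P := spectralmx A; set d := spectral_diag A => AE.
have PU : P \is unitarymx := spectral_unitarymx A.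
have PP := unitarymxP PU.
rewrite invmx_unitary // in AE.
have entry i j : A i j = \sum_k Num.conj (P k i) * d 0 k * P k j.
  rewrite {1}AE mxE; apply: eq_bigr => k _; congr (_ * _).
  by rewrite mul_mx_diag !mxE.
have PPe k l : \sum_i P k i * Num.conj (P l i) = (k == l)%:R.
  have := congr1 (fun M : 'M_n => M k l) PP; rewrite !mxE => <-.
  by apply: eq_bigr => i _; rewrite !mxE.
(* The eigenvalue is the value of the form at the conjugated [k]-th row of [P], a unit
   eigenvector. *)
have d_ge0 k : 0 <= d 0 k.
  have := psdmx_form (fun i => Num.conj (P k i)) Apsd; congr (0 <= _).
  transitivity (\sum_l (\sum_i P k i * Num.conj (P l i)) * d 0 l *
      (\sum_j P l j * Num.conj (P k j))).
    transitivity (\sum_i \sum_j \sum_l P k i * Num.conj (P l i) * d 0 l *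
      (P l j * Num.conj (P k j))).
      apply: eq_bigr => i _; apply: eq_bigr => j _.
      rewrite conjCK entry mulr_sumr mulr_suml; apply: eq_bigr => l _; ring.
    under eq_bigr => i _ do rewrite exchange_big /=.
    rewrite exchange_big; apply: eq_bigr => l _ /=.
    rewrite !mulr_suml; apply: eq_bigr => i _; by rewrite mulr_sumr.
  rewrite (bigD1 k) //= !PPe eqxx mul1r mulr1 big1 ?addr0 // => l /negPf nl.
  by rewrite !PPe eq_sym nl !mul0r.
exists (fun k i => sqrtC (d 0 k) * Num.conj (P k i)) => i j.
rewrite entry; apply: eq_bigr => k _.
have /ger0_real/conj_Creal sC : 0 <= sqrtC (d 0 k) by rewrite sqrtC_ge0 d_ge0.
by rewrite rmorphM /= conjCK sC -[in LHS](sqrtCK (d 0 k)); ring.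
Qed.

End PositiveSemidefinite.

Lemma sum_mxtens (V : nmodType) (m n : nat) (F : 'I_(m * n) -> V) :
  \sum_J F J = \sum_i \sum_j F (mxtens_index (i, j)).
Proof.
rewrite pair_bigA (reindex (@mxtens_index m n)) /=.
  by apply: eq_bigr => -[].
apply: onW_bij; exists (@mxtens_unindex m n); first exact: mxtens_indexK.
exact: mxtens_unindexK.
Qed.

Section Kraus.
Variable C : numClosedFieldType.

Lemma tensmapE (m m' n n' : nat) (L : 'M[C]_m -> 'M[C]_m') (M : 'M[C]_n -> 'M[C]_n')
    (X : 'M[C]_(m * n)) p p' q q' :
  tensmap L M X (mxtens_index (p, p')) (mxtens_index (q, q')) =
  \sum_i \sum_i' \sum_j \sum_j' X (mxtens_index (i, j)) (mxtens_index (i', j')) *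
    (L (delta_mx i i') p q * M (delta_mx j j') p' q').
Proof.
rewrite /tensmap summxE; apply: eq_bigr => i _.
rewrite summxE; apply: eq_bigr => i' _.
rewrite summxE; apply: eq_bigr => j _.
rewrite summxE; apply: eq_bigr => j' _.
by rewrite mxE tensmxE.
Qed.

Lemma tensmap_idE (k n n' : nat) (M : 'M[C]_n -> 'M[C]_n')
    (X : 'M[C]_(k * n)) p p' q q' :
  tensmap (@idfun 'M[C]_k) M X (mxtens_index (p, p')) (mxtens_index (q, q')) =
  \sum_j \sum_j'
    X (mxtens_index (p, j)) (mxtens_index (q, j')) * M (delta_mx j j') p' q'.
Proof.
rewrite tensmapE (bigD1 p) //= [X in _ + X]big1 ?addr0 => [|i /negPf ni].
  rewrite (bigD1 q) //= [X in _ + X]big1 ?addr0 => [|i /negPf ni].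
    apply: eq_bigr => j _; apply: eq_bigr => j' _.
    by rewrite mxE !eqxx mul1r.
  apply: big1 => j _; apply: big1 => j' _.
  by rewrite mxE [q == i]eq_sym ni andbF mul0r mulr0.
apply: big1 => i' _; apply: big1 => j _; apply: big1 => j' _.
by rewrite mxE [p == i]eq_sym ni mul0r mulr0.
Qed.

Lemma delta_tens (m n : nat) (i i' : 'I_m) (j j' : 'I_n) :
  delta_mx (mxtens_index (i, j)) (mxtens_index (i', j')) =
  delta_mx i i' *t delta_mx j j' :> 'M[C]_(m * n).
Proof.
apply/matrixP => p q.
case: (mxtens_indexP p) => p1 p2; case: (mxtens_indexP q) => q1 q2.
rewrite tensmxE !mxE -natrM mulnb.
rewrite !(can_eq (@mxtens_indexK m n)) !xpair_eqE; congr (nat_of_bool _)%:R.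
by case: (p1 == i); case: (p2 == j); case: (q1 == i'); case: (q2 == j').
Qed.

(** Positivity of the rank-one matrix [w w^*], whose quadratic form is a squared modulus. *)
Lemma sum_conj_ge0 (n : nat) (v w : 'I_n -> C) :
  0 <= \sum_i \sum_j Num.conj (v i) * (w i * Num.conj (w j)) * v j.
Proof.
suff -> : \sum_i \sum_j Num.conj (v i) * (w i * Num.conj (w j)) * v j =
    `|\sum_i Num.conj (v i) * w i| ^+ 2 by rewrite exprn_ge0.
rewrite normCK rmorph_sum mulr_suml; apply: eq_bigr => i _.
rewrite mulr_sumr; apply: eq_bigr => j _; rewrite rmorphM /= conjCK; ring.
Qed.

(* The Kraus operators are read off the positive semidefinite Choi matrix, the
   image under [id (x) L] of the unnormalised maximally entangled state. *)
Lemma channel_kraus (m n : nat) (L : channel C m n) :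
  exists K : 'I_(m * n) -> 'I_n -> 'I_m -> C,
    (forall i i' p q, L (delta_mx i i') p q =
       \sum_k K k p i * Num.conj (K k q i')) /\
    (forall i i', \sum_k \sum_p K k p i * Num.conj (K k p i') = (i == i')%:R).
Proof.
pose w (s : 'I_(m * m)) : C :=
  ((mxtens_unindex s).1 == (mxtens_unindex s).2)%:R.
pose Om : 'M[C]_(m * m) := \matrix_(s, t) (w s * Num.conj (w t)).
have Om_psd : psdmx Om.
  apply: psdmxP => v; have := sum_conj_ge0 v w; congr (0 <= _).
  by apply: eq_bigr => i _; apply: eq_bigr => j _; rewrite mxE.
have [u uE] := psdmx_decomp (channel_cp L Om_psd).
have LE i i' p q : L (delta_mx i i') p q =
    \sum_k u k (mxtens_index (i, p)) * Num.conj (u k (mxtens_index (i', q))).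
  (* Block [(i, i')] of the Choi matrix is the image of the matrix unit [delta_mx i i'], since all
     other entries of that block of [Om] vanish. *)
  rewrite -uE tensmap_idE (bigD1 i) //= [X in _ + X]big1 ?addr0 => [|j /negPf nj].
    rewrite (bigD1 i') //= [X in _ + X]big1 ?addr0 => [|j /negPf nj].
      by rewrite mxE /w !mxtens_indexK !eqxx conjC1 !mul1r.
    by rewrite mxE /w !mxtens_indexK /= [i' == j]eq_sym nj conjC0 mulr0 mul0r.
  apply: big1 => j' _.
  by rewrite mxE /w !mxtens_indexK /= [i == j]eq_sym nj !mul0r.
exists (fun k p i => u k (mxtens_index (i, p))); split => // i i'.
rewrite exchange_big; under eq_bigr do rewrite -LE.
have := channel_tp L (delta_mx i i'); rewrite /mxtrace /= => ->.
rewrite (bigD1 i) //= mxE eqxx big1 ?addr0 // => j /negPf nj.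
by rewrite mxE nj.
Qed.

End Kraus.

(** * The upper bound *)

Section UpperBound.
Variables (R : realType) (n : nat).
Local Notation C := R[i].

(** Translates between matrix indices and triples of registers. Only R is read as a bit string, so
    that the same map serves before the channels, where the players also hold auxiliary systems. *)
Definition tri (a b : nat) (p : bits n * 'I_a * 'I_b) : 'I_(qdim n * (a * b)) :=
  mxtens_index (enum_rank p.1.1 : 'I_(qdim n), mxtens_index (p.1.2, p.2)).

Definition tri3 (p : bits3 n) : 'I_(qdim n * (qdim n * qdim n)) :=
  tri (p.1.1, enum_rank p.1.2 : 'I_(qdim n), enum_rank p.2 : 'I_(qdim n)).

Lemma tri_bij a b : bijective (@tri a b).
Proof.
exists (fun p => let: (r, q) := mxtens_unindex p in
  (enum_val (r : 'I_#|bits n|), (mxtens_unindex q).1, (mxtens_unindex q).2)).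
  by case=> [[r i] j]; rewrite /tri !mxtens_indexK enum_rankK.
move=> p; case: (mxtens_indexP p) => r q; case: (mxtens_indexP q) => i j.
by rewrite /tri !mxtens_indexK enum_valK.
Qed.

Lemma tri3_bij : bijective tri3.
Proof.
exists (fun p => (reg_R p, reg_A p, reg_B p)).
  case=> [[r a] b]; rewrite /tri3 /tri /reg_R /reg_A /reg_B !mxtens_indexK.
  by rewrite !enum_rankK.
move=> p; case: (mxtens_indexP p) => r q; case: (mxtens_indexP q) => i j.
rewrite /tri3 /tri /reg_R /reg_A /reg_B !mxtens_indexK.
by rewrite !enum_valK.
Qed.

Lemma winning_projE x (p q : bits3 n) :
  winning_proj R x (tri3 p) (tri3 q) = winningk R x p q.
Proof.
have E (s : bits3 n) :
    [/\ reg_R (tri3 s) = s.1.1, reg_A (tri3 s) = s.1.2 & reg_B (tri3 s) = s.2].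
  by rewrite /tri3 /tri /reg_R /reg_A /reg_B !mxtens_indexK !enum_rankK.
rewrite mxE /winningk /prodk; apply: eq_bigr => i _.
rewrite /local_proj /qubit_Q /at_copy /reg_Q /=.
by have [-> -> ->] := E p; have [-> -> ->] := E q.
Qed.

Lemma mxtrace_winning x (X : 'M[C]_(qdim n * (qdim n * qdim n))) :
  \tr (winning_proj R x *m X) =
  \sum_p \sum_q winningk R x p q * X (tri3 q) (tri3 p).
Proof.
rewrite /mxtrace (reindex tri3) /=; last exact: onW_bij tri3_bij.
apply: eq_bigr => p _; rewrite mxE (reindex tri3) /=; last exact: onW_bij tri3_bij.
by apply: eq_bigr => q _; rewrite winning_projE.
Qed.

(** Stinespring dilation: the Kraus operators are stacked into one isometry, their index becoming
    the environment, and the completeness relation says exactly that the stack is isometric. *)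
Lemma kraus_isometry (d : nat) (L : channel C (qdim n * d) (qdim n)) :
  exists E : bits n * 'I_(qdim n * d * qdim n) -> 'I_(qdim n * d) -> C,
    isometryk E /\
    forall i i' a a', L (delta_mx i i') (enum_rank a) (enum_rank a') =
       \sum_k E (a, k) i * Num.conj (E (a', k) i').
Proof.
have [K [KE KI]] := channel_kraus L.
exists (fun ak i => K ak.2 (enum_rank ak.1) i); split => [i i'|i i' a a'].
  rewrite eq_sym -KI exchange_big (reindex (enum_rank : bits n -> 'I_(qdim n))) /=.
    rewrite pair_bigA; apply: eq_bigr => -[a k] _ /=; exact: mulrC.
  apply: onW_bij; exists (enum_val : 'I_(qdim n) -> bits n).
    exact: enum_rankK.
  exact: enum_valK.
exact: KE.
Qed.

Lemma sum_kraus (I J J' : finType) (v : J -> C) (v' : J' -> C) (G : I -> J -> C)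
    (G' : I -> J' -> C) :
  \sum_j \sum_j' v j * Num.conj (v' j') * \sum_i G i j * Num.conj (G' i j') =
  \sum_i (\sum_j G i j * v j) * Num.conj (\sum_j' G' i j' * v' j').
Proof.
under [RHS]eq_bigr => i _ do rewrite rmorph_sum mulr_suml.
rewrite [RHS]exchange_big; apply: eq_bigr => j _ /=.
under [RHS]eq_bigr => i _ do rewrite mulr_sumr.
rewrite [RHS]exchange_big; apply: eq_bigr => j' _ /=.
by rewrite mulr_sumr; apply: eq_bigr => i _; rewrite rmorphM /=; ring.
Qed.

(** Each pure component is dilated by both isometries, and the sum over [k] and [l] is the partial
    trace over the two environments. *)
Lemma tensmap_kraus (dA dB : nat) (L : channel C (qdim n * dA) (qdim n))
    (M : channel C (qdim n * dB) (qdim n))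
    (E : bits n * 'I_(qdim n * dA * qdim n) -> 'I_(qdim n * dA) -> C)
    (F : bits n * 'I_(qdim n * dB * qdim n) -> 'I_(qdim n * dB) -> C) :
  (forall i i' a a', L (delta_mx i i') (enum_rank a) (enum_rank a') =
     \sum_k E (a, k) i * Num.conj (E (a', k) i')) ->
  (forall i i' a a', M (delta_mx i i') (enum_rank a) (enum_rank a') =
     \sum_k F (a, k) i * Num.conj (F (a', k) i')) ->
  forall (T : finType) (psi : T -> bits n * 'I_(qdim n * dA) * 'I_(qdim n * dB) -> C)
    (rho : 'M[C]_(qdim n * ((qdim n * dA) * (qdim n * dB)))),
  (forall s t, rho (tri s) (tri t) = \sum_m psi m s * Num.conj (psi m t)) ->
  forall p q, tensmap (@idfun 'M[C]_(qdim n)) (tensmap L M) rho (tri3 p) (tri3 q) =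
  \sum_m \sum_k \sum_l
    opA E (opB F (psi m)) (p.1.1, (p.1.2, k), (p.2, l)) *
    Num.conj (opA E (opB F (psi m)) (q.1.1, (q.1.2, k), (q.2, l))).
Proof.
move=> LE ME T psi rho rhoE [[r a] b] [[r' a'] b'] /=.
rewrite /tri3 /tri tensmap_idE /= sum_mxtens pair_bigA /=.
under eq_bigr => i _ do rewrite sum_mxtens pair_bigA /=.
pose G (r : bits n) a b (kl : 'I_(qdim n * dA * qdim n) * 'I_(qdim n * dB * qdim n))
  (ij : 'I_(qdim n * dA) * 'I_(qdim n * dB)) := E (a, kl.1) ij.1 * F (b, kl.2) ij.2.
transitivity (\sum_m \sum_i \sum_j
   psi m (r, i.1, i.2) * Num.conj (psi m (r', j.1, j.2)) *
   \sum_kl G r a b kl i * Num.conj (G r' a' b' kl j)).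
  rewrite [RHS]exchange_big; apply: eq_bigr => i _ /=.
  rewrite [RHS]exchange_big; apply: eq_bigr => j _ /=.
  rewrite -mulr_suml; congr (_ * _); first exact: (rhoE (r, i.1, i.2) (r', j.1, j.2)).
  (* A matrix unit at paired indices is a tensor product of matrix units, on which the joint map
     factors into the two Kraus sums. *)
  rewrite delta_tens tensmap_tens tensmxE LE ME.
  rewrite mulr_suml -(pair_bigA _ (fun k l =>
    G r a b (k, l) i * Num.conj (G r' a' b' (k, l) j))) /=.
  apply: eq_bigr => k _; rewrite mulr_sumr; apply: eq_bigr => l _.
  by rewrite /G rmorphM /=; ring.
apply: eq_bigr => m _; rewrite sum_kraus pair_bigA /=.
have TE s c d k l : \sum_ij G s c d (k, l) ij * psi m (s, ij.1, ij.2) =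
    opA E (opB F (psi m)) (s, (c, k), (d, l)).
  rewrite /opA /opB /=.
  rewrite -(pair_bigA _ (fun i j => G s c d (k, l) (i, j) * psi m (s, i, j))) /=.
  apply: eq_bigr => i _; rewrite mulr_sumr; apply: eq_bigr => j _.
  by rewrite /G mulrA.
by apply: eq_bigr => -[k l] _; rewrite !TE.
Qed.

(** The trace of a projection against a mixture of vectors is the sum of its expectations; the
    environments enter both sides as the same outer sums. *)
Lemma winning_traceE x (dA dB : nat) (L : channel C (qdim n * dA) (qdim n))
    (M : channel C (qdim n * dB) (qdim n))
    (E : bits n * 'I_(qdim n * dA * qdim n) -> 'I_(qdim n * dA) -> C)
    (F : bits n * 'I_(qdim n * dB * qdim n) -> 'I_(qdim n * dB) -> C) :
  (forall i i' a a', L (delta_mx i i') (enum_rank a) (enum_rank a') =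
     \sum_k E (a, k) i * Num.conj (E (a', k) i')) ->
  (forall i i' a a', M (delta_mx i i') (enum_rank a) (enum_rank a') =
     \sum_k F (a, k) i * Num.conj (F (a', k) i')) ->
  forall (T : finType) (psi : T -> bits n * 'I_(qdim n * dA) * 'I_(qdim n * dB) -> C)
    (rho : 'M[C]_(qdim n * ((qdim n * dA) * (qdim n * dB)))),
  (forall s t, rho (tri s) (tri t) = \sum_m psi m s * Num.conj (psi m t)) ->
  complex.Re (\tr (winning_proj R x *m
    tensmap (@idfun 'M[C]_(qdim n)) (tensmap L M) rho)) =
  \sum_m rdot (opA E (opB F (psi m))) (opRAB (winningk R x) (opA E (opB F (psi m)))).
Proof.
move=> LE ME T psi rho rhoE; rewrite -Re_sum mxtrace_winning; congr complex.Re.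
under eq_bigr => p _ do under eq_bigr => q _ do
  rewrite (tensmap_kraus LE ME rhoE) mulr_sumr.
under eq_bigr => p _ do rewrite exchange_big /=.
rewrite exchange_big; apply: eq_bigr => m _ /=; rewrite /dot sum_env.
under eq_bigr => p _ do under eq_bigr => q _ do rewrite pair_bigA mulr_sumr.
under eq_bigr => p _ do rewrite exchange_big /=.
rewrite exchange_big [RHS]pair_bigA; apply: eq_bigr => -[k l] _ /=.
apply: eq_bigr => -[[r a] b] _; rewrite mulr_sumr /=; apply: eq_bigr => q _; ring.
Qed.

Lemma sqrt2_half : 1 / 2 + 1 / (2 * Num.sqrt 2) = 2^-1 * (1 + (Num.sqrt 2)^-1) :> R.
Proof.
have : Num.sqrt 2 != 0 :> R by rewrite sqrtr_eq0 -ltNge.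
by move=> s0; field.
Qed.

Lemma winning_probability_le (S : strategy R n) :
  winning_probability S <= (1 / 2 + 1 / (2 * Num.sqrt 2)) ^+ n.
Proof.
(* The factor [1 / 2 ^ n] of the uniform average cancels against the one pulled out of the bound. *)
rewrite sqrt2_half exprMn exprVn ler_pM2l ?invr_gt0 ?exprn_gt0 //.
have [E HE] := choice (fun x => kraus_isometry (alice S x)).
have [F HF] := choice (fun x => kraus_isometry (bob S x)).
have [psd_rho tr_rho] := shared_stateP S.
have [v vE] := psdmx_decomp psd_rho.
pose psi m p := v m (tri p).
have rhoE s t : shared_state S (tri s) (tri t) = \sum_m psi m s * Num.conj (psi m t).
  exact: vE.
under eq_bigr => x _ do
  rewrite /final_state (winning_traceE x (proj2 (HE x)) (proj2 (HF x)) rhoE).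
rewrite exchange_big.
(* The squared norms of the pure components add up to the trace of the state, which is [1], so the
   bound splits over the components. *)
have -> : (1 + (Num.sqrt 2)^-1) ^+ n =
    \sum_m (1 + (Num.sqrt 2)^-1) ^+ n * rdot (psi m) (psi m) :> R.
  rewrite -mulr_sumr -[LHS]mulr1; congr (_ * _).
  rewrite -Re_sum exchange_big /=.
  have -> : \sum_p \sum_m Num.conj (psi m p) * psi m p = \tr (shared_state S).
    rewrite /mxtrace (reindex (@tri _ _)) /=; last exact: onW_bij (tri_bij _ _).
    apply: eq_bigr => p _; rewrite rhoE; apply: eq_bigr => m _; exact: mulrC.
  by rewrite tr_rho.
apply: ler_sum => m _; apply: sum_winningk_le => x.
  by case: (HE x).
by case: (HF x).
Qed.

End UpperBound.

(** * The cloning strategy *)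

Section Relabelling.
Variable C : numClosedFieldType.

Lemma sum_delta_mx (m : nat) (F : 'I_m -> 'I_m -> C) p q :
  \sum_i \sum_i' F i i' * (delta_mx i i' : 'M[C]_m) p q = F p q.
Proof.
rewrite (bigD1 p) //= [X in _ + X]big1 ?addr0 => [|i /negPf ni].
  rewrite (bigD1 q) //= big1 ?addr0 => [|i /negPf ni].
    by rewrite mxE !eqxx mulr1.
  by rewrite mxE [q == i]eq_sym ni andbF mulr0.
by apply: big1 => i' _; rewrite mxE [p == i]eq_sym ni mulr0.
Qed.

Lemma tensmap_id_mxsub (k m n : nat) (f : 'I_n -> 'I_m) (X : 'M[C]_(k * m)) p p' q q' :
  tensmap (@idfun 'M[C]_k) (mxsub f f) X (mxtens_index (p, p')) (mxtens_index (q, q')) =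
  X (mxtens_index (p, f p')) (mxtens_index (q, f q')).
Proof.
rewrite tensmap_idE -[RHS](sum_delta_mx (fun j j' =>
  X (mxtens_index (p, j)) (mxtens_index (q, j')))).
by apply: eq_bigr => j _; apply: eq_bigr => j' _; rewrite [mxsub _ _ _ _ _]mxE.
Qed.

Lemma tensmap_mxsub (m m' n n' : nat) (f : 'I_m' -> 'I_m) (g : 'I_n' -> 'I_n)
    (X : 'M[C]_(m * n)) p p' q q' :
  tensmap (mxsub f f) (mxsub g g) X (mxtens_index (p, p')) (mxtens_index (q, q')) =
  X (mxtens_index (f p, g p')) (mxtens_index (f q, g q')).
Proof.
rewrite tensmapE.
rewrite -(sum_delta_mx (fun i i' =>
  X (mxtens_index (i, g p')) (mxtens_index (i', g q')))).
apply: eq_bigr => i _; apply: eq_bigr => i' _.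
rewrite -(sum_delta_mx (fun j j' => X (mxtens_index (i, j)) (mxtens_index (i', j')))).
rewrite mulr_suml; apply: eq_bigr => j _.
rewrite mulr_suml; apply: eq_bigr => j' _.
by rewrite ![mxsub _ _ _ _ _]mxE mulrAC mulrA.
Qed.

(** The quadratic form of the image at [v] is that of [X] at [v] with its coordinates permuted. *)
Lemma mxsub_cp (m n : nat) (f : 'I_n -> 'I_m) :
  bijective f -> completely_positive (mxsub f f : 'M[C]_m -> 'M[C]_n).
Proof.
case=> f' fK f'K k X Xpsd.
pose h (s : 'I_(k * n)) : 'I_(k * m) :=
  mxtens_index ((mxtens_unindex s).1, f (mxtens_unindex s).2).
pose h' (s : 'I_(k * m)) : 'I_(k * n) :=
  mxtens_index ((mxtens_unindex s).1, f' (mxtens_unindex s).2).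
have hK : cancel h h'.
  by move=> s; case: (mxtens_indexP s) => i j; rewrite /h /h' !mxtens_indexK fK.
have h'K : cancel h' h.
  by move=> s; case: (mxtens_indexP s) => i j; rewrite /h /h' !mxtens_indexK f'K.
have hbij : bijective h by exists h'.
apply: psdmxP => v; have := psdmx_form (v \o h') Xpsd; congr (0 <= _).
rewrite (reindex h) /=; last exact: onW_bij.
apply: eq_bigr => i _; rewrite (reindex h) /=; last exact: onW_bij.
apply: eq_bigr => j _; rewrite !hK; congr (_ * _ * _).
case: (mxtens_indexP i) => i1 i2; case: (mxtens_indexP j) => j1 j2.
by rewrite /h !mxtens_indexK /= tensmap_id_mxsub.
Qed.

Lemma mxsub_tp (m n : nat) (f : 'I_n -> 'I_m) :
  bijective f -> trace_preserving (mxsub f f : 'M[C]_m -> 'M[C]_n).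
Proof.
move=> fbij X; rewrite /mxtrace [RHS](reindex f) /=; last exact: onW_bij.
by apply: eq_bigr => i _; rewrite mxE.
Qed.

Definition relabel (m n : nat) (f : 'I_n -> 'I_m) (fbij : bijective f) :
  channel C m n := Channel (channel_map := mxsub f f) (mxsub_cp fbij) (mxsub_tp fbij).

End Relabelling.

(** * The clone state and its winning probability *)

Section LowerBound.
Variables (R : realType) (n : nat).
Local Notation C := R[i].

(** The auxiliary systems are one-dimensional. The dimensions [qdim n * 1] and [qdim n] are written
    differently, so doing nothing is encoded as a relabelling of the basis. *)
Definition pad (i : 'I_(qdim n)) : 'I_(qdim n * 1) := mxtens_index (i, ord0).

Lemma pad_bij : bijective pad.
Proof.
exists (fun s => (mxtens_unindex s).1); first by move=> i; rewrite mxtens_indexK.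
by move=> s; case: (mxtens_indexP s) => i j; rewrite /pad mxtens_indexK ord1.
Qed.

Definition tri_pad (p : bits3 n) : 'I_(qdim n * ((qdim n * 1) * (qdim n * 1))) :=
  tri (p.1.1, pad (enum_rank p.1.2), pad (enum_rank p.2)).

Definition untri_pad (s : 'I_(qdim n * ((qdim n * 1) * (qdim n * 1)))) : bits3 n :=
  let t := mxtens_unindex s in let u := mxtens_unindex t.2 in
  (enum_val t.1, enum_val (mxtens_unindex u.1).1, enum_val (mxtens_unindex u.2).1).

Lemma tri_padK : cancel tri_pad untri_pad.
Proof.
move=> [[r a] b].
by rewrite /untri_pad /tri_pad /tri /pad !mxtens_indexK /= !enum_rankK.
Qed.

Lemma untri_padK : cancel untri_pad tri_pad.
Proof.
move=> s; case: (mxtens_indexP s) => r t; case: (mxtens_indexP t) => a b.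
case: (mxtens_indexP a) => a1 a2; case: (mxtens_indexP b) => b1 b2.
by rewrite /untri_pad /tri_pad /tri /pad !mxtens_indexK /= !enum_valK !ord1.
Qed.

Lemma tri_pad_bij : bijective tri_pad.
Proof. by exists untri_pad; [exact: tri_padK | exact: untri_padK]. Qed.

(* Up to the factor [sqrt 2], |Phi+>_RA |0>_B + |Phi+>_RB |0>_A, the top
   eigenvector of the sum of the two winning projections of one copy. *)
Definition clone_amp (s : qubits3) : C :=
  ((s.1.1 == s.1.2) && (s.2 == 0))%:R + ((s.1.1 == s.2) && (s.1.2 == 0))%:R.

Definition clone_vec (p : bits3 n) : C := \prod_i clone_amp (at_copy p i).

Definition clone_state : 'M[C]_(qdim n * ((qdim n * 1) * (qdim n * 1))) :=
  \matrix_(s, t) ((6 ^+ n)^-1 * (clone_vec (untri_pad s) * clone_vec (untri_pad t))).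

Lemma clone_ampJ s : Num.conj (clone_amp s) = clone_amp s.
Proof. by rewrite rmorphD /= !conjC_nat. Qed.

Lemma clone_vecJ p : Num.conj (clone_vec p) = clone_vec p.
Proof. by rewrite rmorph_prod; apply: eq_bigr => i _; exact: clone_ampJ. Qed.

(** In one copy [clone_amp] is [2] at [(0, 0, 0)], [1] at [(1, 1, 0)] and [(1, 0, 1)], and [0]
    elsewhere, with squared norm [4 + 1 + 1 = 6]. *)
Lemma clone_vec_norm : \sum_p clone_vec p * clone_vec p = 6 ^+ n.
Proof.
under eq_bigr do rewrite -big_split /=.
rewrite (big_bits3 (fun _ s => clone_amp s * clone_amp s)).
rewrite -[in RHS](card_ord n) -prodr_const; apply: eq_bigr => i _.
by rewrite sum_qubits3 /clone_amp /=; ring.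
Qed.

Lemma clone_state_quantum : quantum_state clone_state.
Proof.
split.
  apply: psdmxP => v.
  have := mulr_ge0 (_ : 0 <= (6 ^+ n)^-1) (sum_conj_ge0 v (clone_vec \o untri_pad)).
  rewrite invr_ge0 exprn_ge0 // => /(_ isT); congr (0 <= _).
  rewrite mulr_sumr; apply: eq_bigr => i _; rewrite mulr_sumr.
  by apply: eq_bigr => j _; rewrite mxE /= clone_vecJ; ring.
rewrite /mxtrace (reindex tri_pad) /=; last exact: onW_bij tri_pad_bij.
under eq_bigr do rewrite mxE tri_padK.
by rewrite -mulr_sumr clone_vec_norm mulVf // expf_neq0 // pnatr_eq0.
Qed.

Definition clone_strategy : strategy R n :=
  Strategy clone_state_quantum (fun=> relabel C pad_bij) (fun=> relabel C pad_bij).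

(** For either bit the overlap with [|Phi+>] and the remaining qubit in [|0>] is [(2 + 1) / sqrt 2],
    with square [9 / 2], while [|1>] contributes nothing. Dividing by the norm [6] gives [3 / 4]. *)
Lemma clone_local (c : 'I_2) :
  \sum_s \sum_t local_proj R c s t * (clone_amp t * clone_amp s) = 9 / 2.
Proof.
rewrite sum_qubits3 !sum_qubits3 /clone_amp.
by elim/ord2P: c; rewrite ?local_proj0E ?local_proj1E /=; field.
Qed.

Lemma clone_winning x :
  \tr (winning_proj R x *m final_state clone_strategy x) = (3 / 4) ^+ n.
Proof.
rewrite mxtrace_winning.
(* Once the relabelling channels are evaluated, the winning kernel and both amplitudes are products
   over the copies, so the double sum factors. *)
transitivity ((6 ^+ n)^-1 * \sum_(p : bits3 n) \sum_(q : bits3 n)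
    \prod_i (local_proj R (x i) (at_copy p i) (at_copy q i) *
      (clone_amp (at_copy q i) * clone_amp (at_copy p i)))).
  rewrite mulr_sumr; apply: eq_bigr => p _; rewrite mulr_sumr.
  apply: eq_bigr => q _.
  rewrite /final_state /tri3 /tri tensmap_idE /=.
  under eq_bigr => j _ do under eq_bigr => j' _ do rewrite tensmap_mxsub.
  rewrite sum_delta_mx mxE -[mxtens_index (_, mxtens_index _)]/(tri_pad q).
  rewrite -[mxtens_index (enum_rank p.1.1, _)]/(tri_pad p) !tri_padK.
  rewrite big_split [X in _ = _ * (_ * X)]big_split; exact: mulrCA.
under eq_bigr => p _ do rewrite (big_bits3 (fun i q =>
  local_proj R (x i) (at_copy p i) q * (clone_amp q * clone_amp (at_copy p i)))).
rewrite (big_bits3 (fun i p => \sum_q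
  local_proj R (x i) p q * (clone_amp q * clone_amp p))).
under eq_bigr do rewrite clone_local.
rewrite prodr_const card_ord -exprVn -exprMn; congr (_ ^+ n).
by field.
Qed.

Lemma clone_probability : winning_probability clone_strategy = (3 / 4) ^+ n.
Proof.
rewrite /winning_probability; under eq_bigr do rewrite clone_winning.
have -> : (3 / 4) ^+ n = ((3 / 4) ^+ n : R)%:C :> C.
  by rewrite rmorphXn rmorphM fmorphV !rmorph_nat.
rewrite /= sumr_const card_ffun !card_ord -[_ *+ (2 ^ n)%N]mulr_natl natrX.
rewrite mulrA mulVf ?mul1r //.
by rewrite expf_neq0 // pnatr_eq0.
Qed.

End LowerBound.

(** * Both bounds on the supremum over strategies *)

Theorem theorem4 (R : realType) (n : nat) (hn : (1 <= n)%N) :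
  (3 / 4) ^+ n <= optimal_winning_probability R n
    <= (1 / 2 + 1 / (2 * Num.sqrt 2)) ^+ n.
Proof.
have ub : ubound (range (@winning_probability R n))
    ((1 / 2 + 1 / (2 * Num.sqrt 2)) ^+ n).
  by move=> _ [S _ <-]; exact: winning_probability_le.
apply/andP; split.
  (* The lower bound also relies on the upper one: a value lies below the supremum only once the
     range is known to be bounded. *)
  apply: ub_le_sup; first by exists ((1 / 2 + 1 / (2 * Num.sqrt 2)) ^+ n).
  by exists (clone_strategy R n) => //; exact: clone_probability.
apply: ge_sup => //; exists (winning_probability (clone_strategy R n)).
by exists (clone_strategy R n).
Qed.
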